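(* Let $G$ be a finite group, $H=\mathbb{C}[G]$, and let $\mathcal{C}=\{t,x,y,z\}\subset G$ be a cyclic conjugacy class with $4$ elements, labelled so that the table of $\mathrm{Ad}$ given in the context holds. Take the framing defined by the Maurer-Cartan 1-forms $\{e_a\}$ and the coframing $e^{*a}=\sum_{b\in\mathcal{C}}e_b\eta^{b,a}$ with $\eta^{a,b}=\delta_{a,b}+\mu$, $\mu\neq-1/4$ a constant. Let $\{A_a\}_{a\in\mathcal{C}}$ be a torsion free and cotorsion free connection, written in terms of functions $\alpha,\beta,\gamma,\lambda\in H$ with $\alpha+\beta+\gamma+\lambda=-1$ as $$\begin{aligned} A_t&=(1+\alpha)e_t+\gamma e_x+\lambda e_y+\beta e_z,\\ A_x&=\lambda e_t+(1+\beta)e_x+\alpha e_y+\gamma e_z,\\ A_y&=\beta e_t+\lambda e_x+(1+\gamma)e_y+\alpha e_z,\\ A_z&=\gamma e_t+\alpha e_x+\beta e_y+(1+\lambda)e_z \end{aligned}$$ (every torsion free connection has this form). Then $$\begin{aligned} R_t^{-1}(\alpha)&=R_x^{-1}(\lambda)=R_y^{-1}(\beta)=R_z^{-1}(\gamma),\\ R_t^{-1}(\lambda)&=R_x^{-1}(\alpha)=R_y^{-1}(\gamma)=R_z^{-1}(\beta),\\ R_t^{-1}(\beta)&=R_x^{-1}(\gamma)=R_y^{-1}(\alpha)=R_z^{-1}(\lambda),\\ R_t^{-1}(\gamma)&=R_x^{-1}(\beta)=R_y^{-1}(\lambda)=R_z^{-1}(\alpha). \end{aligned}$$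
   Context: Cyclic: a conjugacy class $\mathcal{C}$ with $n\ge 2$ elements in a group $G$ is called cyclic if there exists at least one $t\in\mathcal{C}$ such that $\mathrm{Ad}_t$ (where $\mathrm{Ad}_a(b)=aba^{-1}$) is a cyclic permutation of $\mathcal{C}-\{t\}$ (a single cycle on this set) and the map $a\mapsto \mathrm{Ad}_a(t)$ is a permutation of $\mathcal{C}$. For $n=4$ the elements can be labelled $t,x,y,z$ so that: $\mathrm{Ad}_t$: $t\mapsto t,\ x\mapsto z,\ y\mapsto x,\ z\mapsto y$; $\mathrm{Ad}_x$: $t\mapsto y,\ x\mapsto x,\ y\mapsto z,\ z\mapsto t$; $\mathrm{Ad}_y$: $t\mapsto z,\ x\mapsto t,\ y\mapsto y,\ z\mapsto x$; $\mathrm{Ad}_z$: $t\mapsto x,\ x\mapsto y,\ y\mapsto t,\ z\mapsto z$. Differential calculus: $H=\mathbb{C}[G]$ is the algebra of complex functions on $G$, and $(R_af)(g)=f(ga)$. $\Omega^1(H)$ is the free left $H$-module with basis $\{e_a\}_{a\in\mathcal{C}}$ (the Maurer-Cartan 1-forms), with right module structure $e_af=R_a(f)e_a$, and $\mathrm{d}f=\sum_{a\in\mathcal{C}}(R_af-f)e_a$. Let $\Psi$ be the $H$-bimodule map on $\Omega^1(H)\otimes_H\Omega^1(H)$ with $\Psi(e_a\otimes_H e_b)=e_{aba^{-1}}\otimes_H e_a$. Then $\Omega^2(H)=(\Omega^1(H)\otimes_H\Omega^1(H))/\ker(\mathrm{id}-\Psi)$, with $\wedge$ the image in the quotient, and $\mathrm{d}e_a=\theta\wedge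 e_a+e_a\wedge\theta$, where $\theta=\sum_{a\in\mathcal{C}}e_a$; $\mathrm{d}$ is $\mathbb{C}$-linear on 1-forms with $\mathrm{d}(fe_a)=\mathrm{d}f\wedge e_a+f\,\mathrm{d}e_a$. Connections: a (spin) connection is a collection $\{A_a\}_{a\in\mathcal{C}}$ of 1-forms $A_a\in\Omega^1(H)$. It is torsion free if $\mathrm{d}e_a+\sum_{b\in\mathcal{C}}A_b\wedge(e_{b^{-1}ab}-e_a)=0$ for all $a\in\mathcal{C}$, and cotorsion free (for the coframing $\{e^{*a}\}$) if $\mathrm{d}e^{*a}+\sum_{b\in\mathcal{C}}(e^{*bab^{-1}}-e^{*a})\wedge A_b=0$ for all $a\in\mathcal{C}$. *)

(* Defs.v *)
From HB Require Import structures.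
From mathcomp Require Import all_boot all_order all_algebra all_fingroup.

Set Implicit Arguments.
Unset Strict Implicit.
Unset Printing Implicit Defensive.

Import GRing.Theory.
Local Open Scope ring_scope.
Local Open Scope quotient_scope.

Section CyclicClasses.

Variable gT : finGroupType.

Definition Ad (a b : gT) : gT := (a * b * a^-1)%g.

(* A uniq list on which [Ad t] is an fcycle is exactly a single cycle of the
   permutation [Ad t]. *)
Definition cyclic_class (C : {set gT}) : Prop :=
  [/\ C \in classes [set: gT],
      (2 <= #|C|)%N
    & exists t : gT,
      [/\ t \in C,
          exists s : seq gT, [/\ uniq s, s =i C :\ t & fcycle (Ad t) s],
          {in C &, injective (fun a => Ad a t)}
        & [set Ad a t | a in C] = C]].

Definition cyclic4_table (t x y z : gT) : Prop :=
  [/\ [/\ Ad t t = t, Ad t x = z, Ad t y = x & Ad t z = y],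
      [/\ Ad x t = y, Ad x x = x, Ad x y = z & Ad x z = t],
      [/\ Ad y t = z, Ad y x = t, Ad y y = y & Ad y z = x]
    & [/\ Ad z t = x, Ad z x = y, Ad z y = t & Ad z z = z]].

End CyclicClasses.

Section Calculus.

Variables (K : comNzRingType) (gT : finGroupType).

Local Notation H := {ffun gT -> K}.

Definition Rtr (a : gT) (f : H) : H := [ffun g => f (g * a)%g].

Lemma RtrK (a : gT) : cancel (Rtr a) (Rtr a^-1%g).
Proof. by move=> f; apply/ffunP => g; rewrite !ffunE mulgKV. Qed.

Lemma RtrVK (a : gT) : cancel (Rtr a^-1%g) (Rtr a).
Proof. by move=> f; apply/ffunP => g; rewrite !ffunE mulgK. Qed.

Variable C : {set gT}.

(* An element of the free left H-module on {e_a | a in C} is the family of its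
   left coefficients; Omega1 (x)_H Omega1 is then left-free on the
   e_a (x) e_b. *)
Definition Omega1 : Type := {ffun {a : gT | a \in C} -> H^o}.

Definition Omega1T2 : Type :=
  {ffun {a : gT | a \in C} * {a : gT | a \in C} -> H^o}.

(* Total in a for convenience: [e_ a] is 0 when a is not in C. *)
Definition e_ (a : gT) : Omega1 := [ffun i => (val i == a)%:R : H^o].

Definition rmul1 (u : Omega1) (f : H) : Omega1 :=
  [ffun i => (u i : H) * Rtr (val i) f : H^o].

Lemma e_rmul a (f : H) : rmul1 (e_ a) f = Rtr a f *: e_ a.
Proof.
apply/ffunP=> i; rewrite !ffunE.
have [<-|_] := eqVneq (val i) a; last by rewrite mul0r scaler0.
by rewrite mul1r; apply/esym/mulr1.
Qed.

(* (f e_a) (x) (h e_b) = f R_a(h) e_a (x) e_b *)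
Definition tensor (u v : Omega1) : Omega1T2 :=
  [ffun ij => (u ij.1 : H) * Rtr (val ij.1) (v ij.2) : H^o].

Lemma tensor_balanced u (f : H) (v : Omega1) :
  tensor (rmul1 u f) v = tensor u (f *: v).
Proof.
apply/ffunP=> -[i j]; rewrite !ffunE /=; apply/ffunP=> g; rewrite !ffunE.
by rewrite -mulrA.
Qed.

Definition Psi (w : Omega1T2) : Omega1T2 :=
  \sum_i \sum_j (w (i, j) : H) *: tensor (e_ (Ad (val i) (val j))) (e_ (val i)).

Fact Psi_is_linear : linear Psi.
Proof.
move=> f u v; rewrite /Psi scaler_sumr -big_split /=; apply: eq_bigr => i _.
rewrite scaler_sumr -big_split /=; apply: eq_bigr => j _.
by rewrite !ffunE scalerDl scalerA.
Qed.
HB.instance Definition _ :=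
  GRing.isLinear.Build H Omega1T2 Omega1T2 *:%R Psi Psi_is_linear.

Lemma Psi_basis a b : a \in C -> b \in C ->
  Psi (tensor (e_ a) (e_ b)) = tensor (e_ (Ad a b)) (e_ a).
Proof.
move=> aC bC.
rewrite /Psi (bigD1 (exist _ a aC)) //= [X in _ + X]big1 ?addr0; last first.
  move=> i /eqP ni; rewrite big1 // => j _; rewrite !ffunE /=.
  by case: eqP => [h|_]; [case: ni; apply: val_inj|rewrite mul0r scale0r].
rewrite (bigD1 (exist _ b bC)) //= [X in _ + X]big1 ?addr0; last first.
  move=> j /eqP ni; rewrite !ffunE /=.
  case: eqP => // _; case: eqP => [h|_]; first by case: ni; apply: val_inj.
  rewrite mul1r (_ : Rtr a _ = 0) ?scale0r //.
  by apply/ffunP=> g; rewrite !ffunE.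
rewrite !ffunE /= !eqxx (_ : (_ * _) = 1) ?scale1r //.
by apply/ffunP=> g; rewrite !ffunE mul1r.
Qed.

Definition ker_id_sub_Psi : {pred Omega1T2} := [pred w | w - Psi w == 0].

Fact ker_id_sub_Psi_submod : submod_closed ker_id_sub_Psi.
Proof.
split=> [|f u v]; rewrite !inE; first by rewrite linear0 subrr.
by rewrite !subr_eq0 => /eqP hu /eqP hv; rewrite Psi_is_linear -hu -hv.
Qed.
HB.instance Definition _ :=
  GRing.isSubmodClosed.Build H Omega1T2 ker_id_sub_Psi ker_id_sub_Psi_submod.

Definition Omega2 : Type := {ideal_quot ker_id_sub_Psi}.
HB.instance Definition _ := GRing.Zmodule.on Omega2.

Lemma piO2D (v w : Omega1T2) :
  \pi_Omega2 (v + w) = \pi_Omega2 v + \pi_Omega2 w.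
Proof. exact: Quotient.pi_add. Qed.

Definition scale2 (f : H) (w : Omega2) : Omega2 :=
  \pi_Omega2 (f *: (generic_quotient.repr w : Omega1T2)).

Lemma pi_scale2 (f : H) (w : Omega1T2) :
  \pi_Omega2 (f *: w) = scale2 f (\pi_Omega2 w).
Proof.
apply/eqP; rewrite -Quotient.idealrBE -scalerBr rpredZ //.
by rewrite Quotient.idealrBE reprK.
Qed.

Fact scale2A f g w : scale2 f (scale2 g w) = scale2 (f * g) w.
Proof. by elim/quotW: w => w; rewrite -(pi_scale2 g) -!pi_scale2 scalerA. Qed.
Fact scale21 : left_id 1 scale2.
Proof. by elim/quotW=> w; rewrite -pi_scale2 scale1r. Qed.
Fact scale2Dr : right_distributive scale2 +%R.
Proof.
move=> f; elim/quotW=> u; elim/quotW=> v.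
by rewrite -piO2D -!pi_scale2 scalerDr piO2D.
Qed.
Fact scale2Dl w : {morph scale2^~ w : f g / f + g}.
Proof.
by move=> f g; elim/quotW: w => w; rewrite -!pi_scale2 scalerDl piO2D.
Qed.
HB.instance Definition _ :=
  GRing.Zmodule_isLmodule.Build H Omega2 scale2A scale21 scale2Dr scale2Dl.

Definition wedge (u v : Omega1) : Omega2 := \pi_Omega2 (tensor u v).

Lemma wedge_eq0 u v :
  (wedge u v == 0 :> Omega2) = (Psi (tensor u v) == tensor u v).
Proof.
have h0 : \pi_Omega2 0 = 0 :> Omega2.
  by apply: (addrI (\pi_Omega2 0)); rewrite -piO2D !addr0.
by rewrite -h0 /wedge -Quotient.idealrBE subr0 !inE subr_eq0 eq_sym.
Qed.

Definition theta : Omega1 := \sum_(a in C) e_ a.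

Definition d0 (f : H) : Omega1 := \sum_(a in C) (Rtr a f - f) *: e_ a.

Definition d1 (u : Omega1) : Omega2 :=
  \sum_i (wedge (d0 (u i)) (e_ (val i))
           + (u i : H) *: (wedge theta (e_ (val i)) + wedge (e_ (val i)) theta)).

Lemma d1_leibniz a (f : H) : a \in C ->
  d1 (f *: e_ a)
  = wedge (d0 f) (e_ a) + f *: (wedge theta (e_ a) + wedge (e_ a) theta).
Proof.
move=> aC.
have d00 : d0 (0 : H) = 0.
  rewrite /d0 big1 // => b _; rewrite (_ : Rtr b 0 = 0) ?subrr ?scale0r //.
  by apply/ffunP=> g; rewrite !ffunE.
rewrite /d1 (bigD1 (exist _ a aC)) //= [X in _ + X]big1 ?addr0; last first.
  move=> i /eqP ni; rewrite !ffunE /=.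
  case: eqP => [h|_]; first by case: ni; apply: val_inj.
  rewrite scaler0 d00 scale0r addr0 /wedge (_ : tensor 0 _ = 0).
    by apply: (addrI (\pi_Omega2 0)); rewrite -piO2D !addr0.
  by apply/ffunP=> k; rewrite !ffunE mul0r.
by rewrite !ffunE /= eqxx (_ : f *: (true%:R : H^o) = f) //; apply: mulr1.
Qed.

(* Families indexed by C are given as functions on gT, of which only the values
   on C are used. *)
Definition torsion_free (A : gT -> Omega1) : Prop :=
  forall a, a \in C ->
    d1 (e_ a) + \sum_(b in C) wedge (A b) (e_ (b^-1 * a * b)%g - e_ a) = 0.

Definition cotorsion_free (estar A : gT -> Omega1) : Prop :=
  forall a, a \in C ->
    d1 (estar a)
    + \sum_(b in C) wedge (estar (b * a * b^-1)%g - estar a) (A b) = 0.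

(* e^{*a} = sum_b e_b eta^{b,a}, with eta^{b,a} acting as a constant function *)
Definition coframing (eta : gT -> gT -> K) (a : gT) : Omega1 :=
  \sum_(b in C) rmul1 (e_ b) [ffun=> eta b a].

Definition cyclic4_connection (t x y z : gT) (alpha beta gamma lambda : H)
    (A : gT -> Omega1) : Prop :=
  [/\ A t = (1 + alpha) *: e_ t + gamma *: e_ x + lambda *: e_ y + beta *: e_ z,
      A x = lambda *: e_ t + (1 + beta) *: e_ x + alpha *: e_ y + gamma *: e_ z,
      A y = beta *: e_ t + lambda *: e_ x + (1 + gamma) *: e_ y + alpha *: e_ z
    & A z = gamma *: e_ t + alpha *: e_ x + beta *: e_ y
            + (1 + lambda) *: e_ z].

End Calculus.

Arguments e_ {K gT} C a.
Arguments coframing {K gT} C eta a.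

(* Main.v *)
(* The kernel of id - Psi consists of the tensors whose coefficients satisfy
   w(Ad_i j, i) = w(i, j), so a 1-form equation in Omega^2 is a family of scalar
   equations along the orbits of (i, j) |-> (Ad_i j, i).  For a cyclic class,
   b |-> Ad_b a is a bijection of C, hence each sum over b in the torsion and
   cotorsion equations has a single nonzero term unless a itself is one of the
   two indices involved.  The torsion equations then identify the sixteen
   coefficients A_b^i in four classes (up to the shift by 1 on the diagonal),
   one remaining equation giving alpha + beta + gamma + lambda = -1.  For the
   coframing delta + mu the constant mu cancels, and the cotorsion equations
   equate translates by Ad_i j and by i of two such coefficients; since
   (Ad_i j) i = i j, a further translation turns these into R_i^-1 and R_j^-1. *)
Require Import Defs.
From mathcomp Require Import all_boot all_order all_algebra all_fingroup.
From mathcomp Require Import reals.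
From mathcomp Require Import complex.

Set Implicit Arguments.
Unset Strict Implicit.
Unset Printing Implicit Defensive.

Import Order.TTheory GRing.Theory Num.Theory.
Local Open Scope ring_scope.
Local Open Scope complex_scope.
Local Open Scope quotient_scope.

(** * Coefficients of 1-forms and of 2-tensors *)

Section Coefficients.

Variables (K : comNzRingType) (gT : finGroupType) (C : {set gT}).
Local Notation H := {ffun gT -> K}.
Local Notation Om1 := (Omega1 K C).
Implicit Types (u v : Om1) (w : Omega1T2 K C) (a b i j k : gT) (f : H).

Lemma Rtr_mul a b f : Rtr a (Rtr b f) = Rtr (a * b)%g f.
Proof. by apply/ffunP=> g; rewrite !ffunE mulgA. Qed.

Lemma Rtr_nat a (n : nat) : Rtr a (n%:R : H) = n%:R.
Proof. by apply/ffunP=> g; rewrite ffunE !ffunMnE !ffunE. Qed.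

(* Junk value 0 when a is not in C. *)
Definition coef u a : H :=
  oapp (fun i : {a : gT | a \in C} => (u i : H)) 0 (insub a).

Lemma coef_val u (i : {a : gT | a \in C}) : coef u (val i) = u i.
Proof. by rewrite /coef valK. Qed.

Lemma coefD u v a : coef (u + v) a = coef u a + coef v a.
Proof.
by rewrite /coef; case: insubP => [i _ _|_] /=; rewrite ?ffunE ?addr0.
Qed.

Lemma coefZ f v a : coef (f *: v) a = f * coef v a.
Proof.
by rewrite /coef; case: insubP => [i _ _|_] /=; rewrite ?ffunE ?mulr0.
Qed.

Lemma coef_e a i : i \in C -> coef (e_ C a) i = (i == a)%:R.
Proof. by move=> iC; rewrite (coef_val _ (Sub i iC)) ffunE. Qed.

(** Again 0 outside [C]. Indexing by plain group elements lets [Ad i j] serve as an index without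
    carrying a membership proof. *)
Definition coef2 w i j : H :=
  oapp (fun i' : {a : gT | a \in C} =>
          oapp (fun j' : {a : gT | a \in C} => (w (i', j') : H)) 0 (insub j))
       0 (insub i).

Lemma coef2_val w (i j : {a : gT | a \in C}) :
  coef2 w (val i) (val j) = w (i, j).
Proof. by rewrite /coef2 !valK. Qed.

Lemma coef2_tensor u v i j :
  i \in C -> j \in C -> coef2 (tensor u v) i j = coef u i * Rtr i (coef v j).
Proof.
move=> iC jC; rewrite (coef2_val _ (Sub i iC) (Sub j jC)) ffunE /=.
by rewrite (coef_val _ (Sub i iC)) (coef_val _ (Sub j jC)).
Qed.

Lemma coef2D w w' i j : coef2 (w + w') i j = coef2 w i j + coef2 w' i j.
Proof.
rewrite /coef2; case: insubP => [j' _ _|_]; case: insubP => [i' _ _|_] /=;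
  by rewrite ?ffunE ?addr0.
Qed.

Lemma coef2Z f w i j : coef2 (f *: w) i j = f * coef2 w i j.
Proof.
rewrite /coef2; case: insubP => [j' _ _|_]; case: insubP => [i' _ _|_] /=;
  by rewrite ?ffunE ?mulr0.
Qed.

Lemma coef2_0 i j : coef2 0 i j = 0.
Proof.
rewrite /coef2; case: insubP => [j' _ _|_]; case: insubP => [i' _ _|_] /=;
  by rewrite ?ffunE.
Qed.

Lemma coef2_sum (I : Type) (r : seq I) (P : pred I)
    (F : I -> Omega1T2 K C) i j :
  coef2 (\sum_(n <- r | P n) F n) i j = \sum_(n <- r | P n) coef2 (F n) i j.
Proof. by elim/big_rec2: _ => [|n f w _ <-]; rewrite ?coef2_0 ?coef2D. Qed.

(** The map (i, j) |-> (Ad_i j, i) is injective: its second component gives i, and conjugation by i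
    is injective. So only the (i, j) term of [Psi w] reaches this index. *)
Lemma coef2_Psi w i j : i \in C -> j \in C -> Ad i j \in C ->
  coef2 (Psi w) (Ad i j) i = coef2 w i j.
Proof.
move=> iC jC kC.
rewrite (coef2_val _ (Sub i iC) (Sub j jC)) /Psi coef2_sum.
have cE (i' j' : {a : gT | a \in C}) :
    coef2 ((w (i', j') : H) *: tensor (e_ C (Ad (val i') (val j')))
                                      (e_ C (val i'))) (Ad i j) i
    = (w (i', j') : H) *+ ((Ad i j == Ad (val i') (val j')) && (i == val i')).
  rewrite coef2Z coef2_tensor // !coef_e // Rtr_nat.
  by rewrite -natrM mulnb mulr_natr.
rewrite (bigD1 (Sub i iC)) //= [X in _ + X]big1 ?addr0; last first.
  move=> i' ni; rewrite coef2_sum big1 // => j' _.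
  rewrite cE; case: (i =P val i') => [ii|]; last by rewrite andbF.
  by rewrite -val_eqE /= ii eqxx in ni.
rewrite coef2_sum (bigD1 (Sub j jC)) //= [X in _ + X]big1 ?addr0; last first.
  move=> j' nj; rewrite cE eqxx andbT; case: eqP => // /mulIg /mulgI jj.
  by rewrite -val_eqE /= jj eqxx in nj.
by rewrite cE !eqxx.
Qed.

Lemma piO2_0 : \pi_(Omega2 K C) 0 = 0.
Proof. by apply: (addrI (\pi_(Omega2 K C) 0)); rewrite -piO2D !addr0. Qed.

(** Vanishing in the quotient means [w = Psi w]; this is compared at the index (Ad_i j, i). *)
Lemma pi_eq0_coef2 w i j : \pi_(Omega2 K C) w = 0 ->
  i \in C -> j \in C -> Ad i j \in C -> coef2 w (Ad i j) i = coef2 w i j.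
Proof.
move=> w0 iC jC kC.
have: w - Psi w == 0.
  by have /eqP := w0; rewrite -piO2_0 -Quotient.idealrBE subr0.
rewrite subr_eq0 => /eqP {1}->; exact: coef2_Psi.
Qed.

Lemma pi_sum (I : Type) (r : seq I) (P : pred I) (F : I -> Omega1T2 K C) :
  \sum_(n <- r | P n) \pi_(Omega2 K C) (F n)
  = \pi_(Omega2 K C) (\sum_(n <- r | P n) F n).
Proof. by elim/big_rec2: _ => [|n w w' _ ->]; rewrite ?piO2_0 ?piO2D. Qed.

(** * Exterior derivative of a coframing with constant coefficients *)

Definition cst (c : K) : H := [ffun=> c].

Lemma Rtr_cst a c : Rtr a (cst c) = cst c.
Proof. by apply/ffunP=> g; rewrite !ffunE. Qed.

Lemma cst_nat n : cst n%:R = n%:R.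
Proof. by apply/ffunP=> g; rewrite ffunMnE !ffunE. Qed.

Lemma d0_cst c : d0 C (cst c) = 0.
Proof. by rewrite /d0 big1 // => b _; rewrite Rtr_cst subrr scale0r. Qed.

Lemma coef_theta i : i \in C -> coef (theta K C) i = 1.
Proof.
move=> iC; rewrite (coef_val _ (Sub i iC)) sum_ffunE (bigD1 i) //=.
rewrite ffunE eqxx big1 ?addr0 // => a /andP[_ /negPf ai].
by rewrite ffunE /= eq_sym ai.
Qed.

Lemma coef_coframing eta a i :
  i \in C -> coef (coframing C eta a) i = cst (eta i a).
Proof.
move=> iC; rewrite (coef_val _ (Sub i iC)) sum_ffunE (bigD1 i) //=.
rewrite !ffunE eqxx mul1r big1 ?addr0 => [|b /andP[_ /negPf bi]].
  by rewrite -(Rtr_cst i).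
by rewrite !ffunE /= eq_sym bi mul0r.
Qed.

(** The framing is the coframing with eta = delta, so a single computation of [d1] serves both the
    torsion and the cotorsion equations. *)
Lemma e_coframing a : e_ C a = coframing C (fun i b => (i == b)%:R) a :> Om1.
Proof.
apply/ffunP=> i; rewrite -!coef_val coef_coframing ?coef_e ?cst_nat //;
  exact: valP.
Qed.

(** Constants are killed by [d0], so only the terms in theta (x) e_k + e_k (x) theta survive. All
    coefficients of theta are 1, so at (i, j) the first tensor selects k = j and the second k =
    i. *)
Lemma d1_coframing eta a :
  exists2 w : Omega1T2 K C, d1 (coframing C eta a) = \pi_(Omega2 K C) w
    & {in C &, forall i j, coef2 w i j = cst (eta i a + eta j a)}.
Proof.
exists (\sum_(k : {k : gT | k \in C}) (cst (eta (val k) a)) *: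
   (tensor (theta K C) (e_ C (val k)) + tensor (e_ C (val k)) (theta K C))).
  rewrite -pi_sum; apply: eq_bigr => k _.
  rewrite -coef_val coef_coframing; last exact: valP.
  rewrite pi_scale2 piO2D (_ : wedge _ _ = 0) ?add0r //.
  rewrite /wedge -piO2_0; congr (\pi_(Omega2 K C) _).
  by apply/ffunP=> ij; rewrite ffunE d0_cst !ffunE mul0r.
move=> i j iC jC; rewrite coef2_sum.
have tE (k : {k : gT | k \in C}) : coef2 (cst (eta (val k) a) *:
   (tensor (theta K C) (e_ C (val k)) + tensor (e_ C (val k)) (theta K C))) i j
   = cst (eta (val k) a) *+ (k == Sub j jC)
     + cst (eta (val k) a) *+ (k == Sub i iC).
  rewrite coef2Z coef2D !coef2_tensor // !coef_theta // !coef_e // Rtr_nat.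
  rewrite mul1r (Rtr_nat i 1) mulr1 mulrDr !mulr_natr -!val_eqE /=.
  by rewrite (eq_sym i) (eq_sym j).
have pick1 (l : {k : gT | k \in C}) :
    \sum_k cst (eta (val k) a) *+ (k == l) = cst (eta (val l) a).
  rewrite (bigD1 l) //= eqxx big1 ?addr0 // => k /negPf ->.
  by rewrite mulr0n.
under eq_bigr do rewrite tE.
rewrite big_split /= !pick1 addrC.
by apply/ffunP=> g; rewrite !ffunE.
Qed.

(** * Torsion and cotorsion equations in coefficients *)

(** The equation lives in a quotient, so it is lifted to a tensor [w] that represents 0. The form
    e_(b^-1 a b) contributes at j exactly when Ad_b j = a; its coefficients being constant, no
    translation appears. *)
Lemma torsion_free_coef2 A a :
  torsion_free A -> a \in C -> exists2 w : Omega1T2 K C, \pi_(Omega2 K C) w = 0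
    & {in C &, forall i j, coef2 w i j = (i == a)%:R + (j == a)%:R
        + \sum_(b in C) coef (A b) i * ((Ad b j == a)%:R - (j == a)%:R)}.
Proof.
move=> tfA aC; have := tfA a aC; rewrite {1}e_coframing.
have [w -> wE] := d1_coframing (fun i b => (i == b)%:R) a.
rewrite pi_sum -piO2D => w0; eexists; first exact: w0.
move=> i j iC jC; rewrite coef2D wE // coef2_sum; congr (_ + _).
  by rewrite -!cst_nat; apply/ffunP=> g; rewrite !ffunE.
apply: eq_bigr => b _; rewrite coef2_tensor // -scaleN1r coefD coefZ !coef_e //.
congr (_ * _); rewrite mulN1r (_ : (j == _) = (Ad b j == a)).
  by apply/ffunP=> g; rewrite -!cst_nat !ffunE.
rewrite /Ad -(inj_eq (mulgI b)) -(inj_eq (mulIg b^-1%g)).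
by rewrite !mulgA mulgV mul1g mulgK.
Qed.

(** Here A_b is the right-hand factor, so its coefficient is translated by [Rtr i]; this is the
    source of the translations in the final relations. *)
Lemma cotorsion_free_coef2 eta A a :
  cotorsion_free (coframing C eta) A -> a \in C ->
  exists2 w : Omega1T2 K C, \pi_(Omega2 K C) w = 0
    & {in C &, forall i j, coef2 w i j = cst (eta i a + eta j a)
        + \sum_(b in C) cst (eta i (Ad b a) - eta i a) * Rtr i (coef (A b) j)}.
Proof.
move=> ctA aC; have := ctA a aC.
have [w -> wE] := d1_coframing eta a.
rewrite pi_sum -piO2D => w0; eexists; first exact: w0.
move=> i j iC jC; rewrite coef2D wE // coef2_sum; congr (_ + _).
apply: eq_bigr => b _; rewrite coef2_tensor // -scaleN1r coefD coefZ.
rewrite !coef_coframing //; congr (_ * _).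
by rewrite mulN1r; apply/ffunP=> g; rewrite !ffunE.
Qed.

(** * Scalar relations when b |-> Ad_b a is injective on the class *)

Lemma RtrD a f g : Rtr a (f + g) = Rtr a f + Rtr a g.
Proof. by apply/ffunP=> h; rewrite !ffunE. Qed.

Lemma Rtr_add1 a f : Rtr a (1 + f) = 1 + Rtr a f.
Proof. by rewrite RtrD (Rtr_nat a 1). Qed.

Hypothesis Ad_free : {in C, forall a, {in C &, injective (fun b => Ad b a)}}.

Lemma sum_Ad_delta (F : gT -> H) a b0 c : a \in C -> b0 \in C -> Ad b0 a = c ->
  \sum_(b in C) F b * (Ad b a == c)%:R = F b0.
Proof.
move=> aC b0C <-; rewrite (bigD1 b0) //= eqxx mulr1 big1 ?addr0 //.
move=> b /andP[bC /negPf nb].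
by rewrite (inj_in_eq (Ad_free aC)) // nb mulr0.
Qed.

(** With i and j different from a, each sum collapses to one term at both (i, j) and (k, i). If k =
    a then Ad_b j = Ad_i j forces b = i, so the shift by 1 falls on a diagonal coefficient. *)
Lemma torsion_free_rel A i j k a b c : torsion_free A ->
  i \in C -> j \in C -> k \in C -> a \in C -> b \in C -> c \in C ->
  i != a -> j != a -> Ad i j = k -> Ad b j = a -> Ad c i = a ->
  coef (A b) i = (k == a)%:R + coef (A c) k.
Proof.
move=> tfA iC jC kC aC bC cC /negPf ia /negPf ja ijk bja cia.
have [w w0 wE] := torsion_free_coef2 tfA aC.
have := pi_eq0_coef2 w0 iC jC; rewrite ijk !wE // ia ja => /(_ kC).
under eq_bigr do rewrite subr0.
under [in RHS]eq_bigr do rewrite subr0.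
rewrite (sum_Ad_delta _ jC bC bja) (sum_Ad_delta _ iC cC cia).
by rewrite !add0r addr0 => ->.
Qed.

(** This is the case j = a: the summand -[j = a] is then present for every b and produces the full
    sum of the A_b^i. *)
Lemma torsion_free_sum A i k a c : torsion_free A ->
  i \in C -> k \in C -> a \in C -> c \in C ->
  i != a -> k != a -> Ad i a = k -> Ad c i = a ->
  \sum_(b in C) coef (A b) i = 1 + coef (A a) i - coef (A c) k.
Proof.
move=> tfA iC kC aC cC /negPf ia /negPf ka iak cia.
have [w w0 wE] := torsion_free_coef2 tfA aC.
have := pi_eq0_coef2 w0 iC aC; rewrite iak !wE // ia ka eqxx => /(_ kC).
under eq_bigr do rewrite subr0.
under [in RHS]eq_bigr do rewrite mulrBr mulr1.
have aa : Ad a a = a by rewrite /Ad mulgK.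
rewrite sumrB (sum_Ad_delta _ aC aC aa) (sum_Ad_delta _ iC cC cia) !add0r => ->.
by rewrite addrA subKr.
Qed.

(* The coefficients at [(k, i)] and [(i, j)] give
   R_k (A_c^i) = [j = a] + R_i (A_b^j); since k i = i j, applying the inverse
   translation R_(ij)^-1 leaves R_i^-1 on the left and R_j^-1 on the right. *)
Lemma cotorsion_free_rel (mu : K) A i j k a b c :
  cotorsion_free (coframing C (fun i a => (i == a)%:R + mu)) A ->
  i \in C -> j \in C -> k \in C -> a \in C -> b \in C -> c \in C ->
  i != a -> k != a -> Ad i j = k -> Ad b a = i -> Ad c a = k ->
  (j == a)%:R + Rtr j^-1%g (coef (A b) j) = Rtr i^-1%g (coef (A c) i).
Proof.
move=> ctA iC jC kC aC bC cC /negPf ia /negPf ka ijk bai cak.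
have [w w0 wE] := cotorsion_free_coef2 ctA aC.
have := pi_eq0_coef2 w0 iC jC; rewrite ijk !wE // ia ka => /(_ kC).
(* The constant mu cancels in the difference of eta values; [false] is the already decided test that
   n differs from a. *)
have sE (n m : gT) d : n \in C -> d \in C -> Ad d a = n -> (n == a) = false ->
  \sum_(b0 in C) cst ((n == Ad b0 a)%:R + mu - (false%:R + mu))
    * Rtr n (coef (A b0) m) = Rtr n (coef (A d) m).
  move=> nC dC dan na.
  rewrite -(sum_Ad_delta (fun b0 => Rtr n (coef (A b0) m)) aC dC dan).
  apply: eq_bigr => b0 _; rewrite add0r addrK eq_sym cst_nat.
  by rewrite mulr_natl mulr_natr.
rewrite (sE k i c) // (sE i j b) // => E.
(* Both sides carry the contribution 2 mu of [d1], which is cancelled here. *)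
have {}E : Rtr k (coef (A c) i) = (j == a)%:R + Rtr i (coef (A b) j).
  apply: (addrI (cst (mu + mu))); rewrite [RHS]addrA; move: E.
  rewrite !add0r => ->; congr (_ + _).
  by rewrite -cst_nat; apply/ffunP=> g; rewrite !ffunE addrCA addrC.
have ki : (i * j = k * i)%g by rewrite -ijk /Ad mulgKV.
have := congr1 (Rtr (i * j)^-1%g) E; rewrite RtrD Rtr_nat !Rtr_mul.
by rewrite {1}ki !invMg !mulgKV => ->.
Qed.

End Coefficients.

(** * The cyclic class with four elements *)

(** For each a, the table lists four distinct values Ad_t a, Ad_x a, Ad_y a, Ad_z a. A coincidence
    for b and c distinct would identify two of t, x, y, z. *)
Lemma cyclic4_Ad_free (gT : finGroupType) (t x y z : gT) :
  uniq [:: t; x; y; z] -> cyclic4_table t x y z ->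
  {in [set t; x; y; z], forall a,
    {in [set t; x; y; z] &, injective (fun b => Ad b a)}}.
Proof.
rewrite /= !inE !negb_or => /and4P[/and3P[tx ty tz] /andP[xy xz] yz _].
case=> [[ttE txE tyE tzE] [xtE xxE xyE xzE] [ytE yxE yyE yzE]
        [ztE zxE zyE zzE]].
move=> a + b c; rewrite !inE -!orbA.
by case/or4P=> /eqP->; case/or4P=> /eqP->; case/or4P=> /eqP->;
  rewrite ?(ttE, txE, tyE, tzE, xtE, xxE, xyE, xzE, ytE, yxE, yyE, yzE,
    ztE, zxE, zyE, zzE) // => E; move: tx ty tz xy xz yz;
  rewrite E eqxx.
Qed.

Section Cyclic4.

Variables (K : comNzRingType) (gT : finGroupType) (t x y z : gT).
Local Notation C := [set t; x; y; z].
Local Notation H := {ffun gT -> K}.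
Local Notation Om1 := (Omega1 K C).

Hypothesis uC : uniq [:: t; x; y; z].
Hypothesis AdC : cyclic4_table t x y z.

Lemma sum_set4 (V : zmodType) (F : gT -> V) :
  \sum_(a in C) F a = F t + F x + F y + F z.
Proof.
have /= := uC; rewrite !inE !negb_or.
case/and4P=> /and3P[tx ty tz] /andP[xy xz] yz _.
rewrite -!setUA !big_setU1 ?big_set1 ?inE ?negb_or ?tx ?ty ?xy ?xz //=.
by rewrite !addrA.
Qed.

Lemma coef_comb4 (f1 f2 f3 f4 : H) (u : Om1) :
  u = f1 *: e_ C t + f2 *: e_ C x + f3 *: e_ C y + f4 *: e_ C z ->
  [/\ coef u t = f1, coef u x = f2, coef u y = f3 & coef u z = f4].
Proof.
have /= := uC; rewrite !inE !negb_or.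
case/and4P=> /and3P[/negPf tx /negPf ty /negPf tz].
case/andP=> /negPf xy /negPf xz /negPf yz _ ->.
by split; rewrite !coefD !coefZ !coef_e ?inE ?eqxx ?orbT //
  ?(eq_sym x t) ?(eq_sym y t) ?(eq_sym z t) ?(eq_sym y x) ?(eq_sym z x)
  ?(eq_sym z y) ?tx ?ty ?tz ?xy ?xz ?yz ?mulr1 ?mulr0 ?addr0 ?add0r.
Qed.

Lemma Omega1_sum4 (u : Om1) :
  u = coef u t *: e_ C t + coef u x *: e_ C x + coef u y *: e_ C y
      + coef u z *: e_ C z.
Proof.
have [ct cx cy cz] := coef_comb4 (erefl (coef u t *: e_ C t + coef u x *: e_ C x
  + coef u y *: e_ C y + coef u z *: e_ C z)).
apply/ffunP=> i; rewrite -!coef_val; have := valP i; rewrite !inE -!orbA.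
by case/or4P=> /eqP->.
Qed.

Lemma torsion_free4 (A : gT -> Om1) : torsion_free A ->
  exists alpha beta gamma lambda : H,
    alpha + beta + gamma + lambda = -1 /\
    cyclic4_connection t x y z alpha beta gamma lambda A.
Proof.
move=> tfA; have free := cyclic4_Ad_free uC AdC.
have /= := uC; rewrite !inE !negb_or.
case/and4P=> /and3P[/negPf tx /negPf ty /negPf tz].
case/andP=> /negPf xy /negPf xz /negPf yz _.
have [[ttE txE tyE tzE] [xtE xxE xyE xzE] [ytE yxE yyE yzE]
        [ztE zxE zyE zzE]] := AdC.
pose ne := (tx, ty, tz, xy, xz, yz, eq_sym x t, eq_sym y t, eq_sym z t,
  eq_sym y x, eq_sym z x, eq_sym z y).
have [tC xC yC zC] : [/\ t \in C, x \in C, y \in C & z \in C].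
  by split; rewrite !inE eqxx ?orbT.
have tor i j k a b c := @torsion_free_rel K gT C free A i j k a b c tfA.
(* Twelve instances of [tor], three for each of the four classes, reduce every coefficient to one of
   A_z^x, A_t^z, A_t^x, A_t^y. *)
have Att : coef (A t) t = 1 + coef (A z) x
  by rewrite (tor t y x x t z) ?ne ?eqxx.
have Axy : coef (A x) y = coef (A z) x
  by rewrite (tor y z x t x z) ?ne ?add0r.
have Ayz : coef (A y) z = coef (A z) x
  by rewrite (tor z x y t y x) ?ne ?add0r.
have Axx : coef (A x) x = 1 + coef (A t) z
  by rewrite (tor x y z z x t) ?ne ?eqxx.
have Azy : coef (A z) y = coef (A t) z
  by rewrite (tor y t z x z t) ?ne ?add0r.
have Ayt : coef (A y) t = coef (A t) z
  by rewrite (tor t z y x y z) ?ne ?add0r.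
have Ayy : coef (A y) y = 1 + coef (A t) x
  by rewrite (tor y z x x y t) ?ne ?eqxx.
have Axz : coef (A x) z = coef (A t) x
  by rewrite (tor z t x y x t) ?ne ?add0r.
have Azt : coef (A z) t = coef (A t) x
  by rewrite (tor t x z y z x) ?ne ?add0r.
have Azz : coef (A z) z = 1 + coef (A t) y
  by rewrite (tor z x y y z t) ?ne ?eqxx.
have Ayx : coef (A y) x = coef (A t) y
  by rewrite (tor x t y z y t) ?ne ?add0r.
have Axt : coef (A x) t = coef (A t) y
  by rewrite (tor t y x z x y) ?ne ?add0r.
(* Each witness is an off-diagonal member of its class, so it carries no shift by 1. *)
exists (coef (A z) x), (coef (A t) z), (coef (A t) x), (coef (A t) y).
split.
  (* With i = x and a = t, the right-hand side is 1 + A_t^x - A_y^y, which is 0 by [Ayy]. The 1 in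
     A_x^x then gives the value -1 of the sum. *)
  have := @torsion_free_sum K gT C free A x y t y tfA.
  rewrite !ne sum_set4 Axx Ayx Ayy subrr.
  move=> /(_ xC yC tC yC isT isT xtE yxE) S.
  apply: (addrI 1); rewrite subrr -S !addrA.
  by rewrite [RHS](AC 5%AC (2*5*3*1*4)%AC).
by split; rewrite [LHS]Omega1_sum4 ?Att ?Axt ?Axx ?Axy ?Axz ?Ayt ?Ayx ?Ayy ?Ayz
  ?Azt ?Azy ?Azz.
Qed.

Lemma cotorsion_free4 (mu : K) (A : gT -> Om1)
    (alpha beta gamma lambda : H) :
  cotorsion_free (coframing C (fun a b => (a == b)%:R + mu)) A ->
  cyclic4_connection t x y z alpha beta gamma lambda A ->
  [/\ [/\ Rtr t^-1%g alpha = Rtr x^-1%g lambda,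
          Rtr x^-1%g lambda = Rtr y^-1%g beta
        & Rtr y^-1%g beta = Rtr z^-1%g gamma],
      [/\ Rtr t^-1%g lambda = Rtr x^-1%g alpha,
          Rtr x^-1%g alpha = Rtr y^-1%g gamma
        & Rtr y^-1%g gamma = Rtr z^-1%g beta],
      [/\ Rtr t^-1%g beta = Rtr x^-1%g gamma,
          Rtr x^-1%g gamma = Rtr y^-1%g alpha
        & Rtr y^-1%g alpha = Rtr z^-1%g lambda]
    & [/\ Rtr t^-1%g gamma = Rtr x^-1%g beta,
          Rtr x^-1%g beta = Rtr y^-1%g lambda
        & Rtr y^-1%g lambda = Rtr z^-1%g alpha]].
Proof.
move=> ctA [At Ax Ay Az]; have free := cyclic4_Ad_free uC AdC.
have [Att Atx Aty Atz] := coef_comb4 At.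
have [Axt Axx Axy Axz] := coef_comb4 Ax.
have [Ayt Ayx Ayy Ayz] := coef_comb4 Ay.
have [Azt Azx Azy Azz] := coef_comb4 Az.
have /= := uC; rewrite !inE !negb_or.
case/and4P=> /and3P[/negPf tx /negPf ty /negPf tz].
case/andP=> /negPf xy /negPf xz /negPf yz _.
have [[ttE txE tyE tzE] [xtE xxE xyE xzE] [ytE yxE yyE yzE]
        [ztE zxE zyE zzE]] := AdC.
pose ne := (tx, ty, tz, xy, xz, yz, eq_sym x t, eq_sym y t, eq_sym z t,
  eq_sym y x, eq_sym z x, eq_sym z y).
have [tC xC yC zC] : [/\ t \in C, x \in C, y \in C & z \in C].
  by split; rewrite !inE eqxx ?orbT.
have cot i j k a b c := @cotorsion_free_rel K gT C free mu A i j k a b c ctA.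
(* Each equality is one instance of [cot]: a is chosen outside {i, k}, and b, c are then forced by
   Ad_b a = i and Ad_c a = k. Taking a = j forces c = i and brings in the diagonal coefficient
   A_i^i; in those cases 1 is first added to both sides. *)
split; split.
- apply: (addrI 1).
  by rewrite -Rtr_add1 -Att -(cot t x z x y t) ?ne ?eqxx ?Ayx.
- by rewrite -Ayx -(cot x y z t z y) ?ne ?add0r ?Azy.
- by rewrite -Azy -(cot y z x t x z) ?ne ?add0r ?Axz.
- by rewrite -Axt -(cot t x z y z x) ?ne ?add0r ?Azx.
- apply: (addrI 1).
  by rewrite -[RHS]Rtr_add1 -Ayy -(cot y x t x z y) ?ne ?eqxx ?Azx.
- apply: (addrI 1).
  by rewrite -Rtr_add1 -Ayy -(cot y z x z t y) ?ne ?eqxx ?Atz.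
- by rewrite -Atx -(cot x t y z y t) ?ne ?add0r ?Ayt.
- by rewrite -Axy -(cot y x t z t x) ?ne ?add0r ?Atx.
- apply: (addrI 1).
  by rewrite -[RHS]Rtr_add1 -Azz -(cot z y t y x z) ?ne ?eqxx ?Axy.
- apply: (addrI 1).
  by rewrite -[RHS]Rtr_add1 -Axx -(cot x t y t z x) ?ne ?eqxx ?Azt.
- apply: (addrI 1).
  by rewrite -Rtr_add1 -Axx -(cot x y z y t x) ?ne ?eqxx ?Aty.
- by rewrite -Ayz -(cot z y t x t y) ?ne ?add0r ?Aty.
Qed.

End Cyclic4.

(** * The result for complex functions *)

Theorem proposition3p7 (R : realType) (gT : finGroupType) (C : {set gT})
    (t x y z : gT) (mu : R[i]) :
  cyclic_class C ->
  uniq [:: t; x; y; z] ->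
  C = [set t; x; y; z] ->
  cyclic4_table t x y z ->
  mu != - (4%:R)^-1 ->
  (forall A : gT -> Omega1 R[i] C,
     torsion_free A ->
     exists alpha beta gamma lambda : {ffun gT -> R[i]},
       alpha + beta + gamma + lambda = -1 /\
       cyclic4_connection t x y z alpha beta gamma lambda A)
  /\
  (forall (A : gT -> Omega1 R[i] C)
          (alpha beta gamma lambda : {ffun gT -> R[i]}),
     torsion_free A ->
     cotorsion_free (coframing C (fun a b => (a == b)%:R + mu)) A ->
     alpha + beta + gamma + lambda = -1 ->
     cyclic4_connection t x y z alpha beta gamma lambda A ->
     [/\ [/\ Rtr t^-1%g alpha = Rtr x^-1%g lambda,
             Rtr x^-1%g lambda = Rtr y^-1%g beta
           & Rtr y^-1%g beta = Rtr z^-1%g gamma],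
         [/\ Rtr t^-1%g lambda = Rtr x^-1%g alpha,
             Rtr x^-1%g alpha = Rtr y^-1%g gamma
           & Rtr y^-1%g gamma = Rtr z^-1%g beta],
         [/\ Rtr t^-1%g beta = Rtr x^-1%g gamma,
             Rtr x^-1%g gamma = Rtr y^-1%g alpha
           & Rtr y^-1%g alpha = Rtr z^-1%g lambda]
       & [/\ Rtr t^-1%g gamma = Rtr x^-1%g beta,
             Rtr x^-1%g beta = Rtr y^-1%g lambda
           & Rtr y^-1%g lambda = Rtr z^-1%g alpha]]).
Proof.
move=> _ uC -> AdC _; split=> [A|A alpha beta gamma lambda _ ctA _].
  exact: torsion_free4.
exact: cotorsion_free4 ctA.
Qed.
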